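(* Let $\mathbf x=(x_1,x_2,x_3,x_4,x_5,x_6,x_7)\in\mathbb C^7$. Then $\mathbf x\in\Gamma_{E(3;3;1,1,1)}$ if and only if $(x_1,\,x_3+\eta x_5,\,\eta x_7,\,x_2+\eta x_4,\,\eta x_6)\in\Gamma_{E(3;2;1,2)}$ for all $\eta\in\mathbb T$.
   Context: $\mathbb T$ is the unit circle. For a linear subspace $E$ of $\mathcal M_{n\times n}(\mathbb C)$, $\mu_E(A)=1/\inf\{\|X\|: X\in E,\ \det(I-AX)=0\}$, with $\mu_E(A)=0$ if $I-AX$ is nonsingular for all $X\in E$ (operator norm). $E(3;3;1,1,1)$ is the space of $3\times 3$ diagonal matrices and $E(3;2;1,2)=\{\operatorname{diag}(z_1,z_2,z_2): z_1,z_2\in\mathbb C\}$. For $A=((a_{ij}))\in\mathcal M_{3\times3}(\mathbb C)$ put $$\pi(A)=\big(a_{11},\ a_{22},\ a_{11}a_{22}-a_{12}a_{21},\ a_{33},\ a_{11}a_{33}-a_{13}a_{31},\ a_{22}a_{33}-a_{23}a_{32},\ \det A\big),$$ $$\tilde\pi(A)=\big(a_{11},\ (a_{11}a_{22}-a_{12}a_{21})+(a_{11}a_{33}-a_{13}a_{31}),\ \det A,\ a_{22}+a_{33},\ a_{22}a_{33}-a_{23}a_{32}\big).$$ Then $\Gamma_{E(3;3;1,1,1)}=\{\pi(A): \mu_{E(3;3;1,1,1)}(A)\le1\}\subset\mathbb C^7$ and $\Gamma_{E(3;2;1,2)}=\{\tilde\pi(A): \mu_{E(3;2;1,2)}(A)\le1\}\subset\mathbb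 C^5$, with $A$ ranging over $\mathcal M_{3\times 3}(\mathbb C)$. *)

(* Defs.v *)
From mathcomp Require Import all_boot all_order all_algebra.
From mathcomp Require Import complex.
From mathcomp Require Import boolp classical_sets reals.

Set Implicit Arguments.
Unset Strict Implicit.
Unset Printing Implicit Defensive.

Import Order.TTheory GRing.Theory Num.Theory.
Local Open Scope classical_set_scope.
Local Open Scope ring_scope.
Local Open Scope complex_scope.

Definition l2norm (R : realType) n (v : 'cV[R[i]]_n) : R :=
  Num.sqrt (\sum_(i < n) complex.Re `|v i 0| ^+ 2).

Definition opnorm (R : realType) n (X : 'M[R[i]]_n) : R :=
  sup [set l2norm (X *m v) | v in [set v : 'cV[R[i]]_n | l2norm v <= 1]].

Definition singularizers (R : realType) n (E : set 'M[R[i]]_n) (A : 'M[R[i]]_n)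
    : set 'M[R[i]]_n :=
  [set X | E X /\ \det (1%:M - A *m X) = 0].

(* Meant for E a linear subspace.  When singularizers E A is nonempty, the
   infimum is positive (I - AX is invertible as soon as ||A|| ||X|| < 1), so
   the convention 0^-1 = 0 is never used. *)
Definition mu (R : realType) n (E : set 'M[R[i]]_n) (A : 'M[R[i]]_n) : R :=
  if `[< singularizers E A = set0 >] then 0
  else (inf [set opnorm X | X in singularizers E A])^-1.

Definition E_3_3_111 (R : realType) : set 'M[R[i]]_3 :=
  [set X | exists z1 z2 z3 : R[i],
     X = diag_mx (\row_(j < 3) [:: z1; z2; z3]`_j)].

Definition E_3_2_12 (R : realType) : set 'M[R[i]]_3 :=
  [set X | exists z1 z2 : R[i],
     X = diag_mx (\row_(j < 3) [:: z1; z2; z2]`_j)].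

(* Indices start at 0: the entry a_{ij} of the mathematical text is
   A (i - 1) (j - 1). *)
Definition pi_111 (R : realType) (A : 'M[R[i]]_3) : 7.-tuple R[i] :=
  [tuple A 0 0;
         A 1 1;
         A 0 0 * A 1 1 - A 0 1 * A 1 0;
         A 2 2;
         A 0 0 * A 2 2 - A 0 2 * A 2 0;
         A 1 1 * A 2 2 - A 1 2 * A 2 1;
         \det A].

Definition pi_12 (R : realType) (A : 'M[R[i]]_3) : 5.-tuple R[i] :=
  [tuple A 0 0;
         (A 0 0 * A 1 1 - A 0 1 * A 1 0) + (A 0 0 * A 2 2 - A 0 2 * A 2 0);
         \det A;
         A 1 1 + A 2 2;
         A 1 1 * A 2 2 - A 1 2 * A 2 1].

Definition Gamma_3_3_111 (R : realType) : set (7.-tuple R[i]) :=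
  [set pi_111 A | A in [set A | mu (@E_3_3_111 R) A <= 1]].

Definition Gamma_3_2_12 (R : realType) : set (5.-tuple R[i]) :=
  [set pi_12 A | A in [set A | mu (@E_3_2_12 R) A <= 1]].

(* Main.v *)
Require Import Defs.
From mathcomp Require Import all_boot all_order all_algebra.
From mathcomp Require Import complex ring.
From mathcomp Require Import boolp classical_sets reals.

Set Implicit Arguments.
Unset Strict Implicit.
Unset Printing Implicit Defensive.

Import Order.TTheory GRing.Theory Num.Theory.
Local Open Scope ring_scope.
Local Open Scope complex_scope.

(** Put P(z1,z2,z3) = det (I - A diag(z1,z2,z3)), a polynomial whose
    coefficients are, up to sign, the entries of pi(A).  Then mu(A) <= 1 means
    that P has no zero in the open polydisc, and every x in C^7 is some pi(A);
    so membership in either domain is a nonvanishing condition on x.  The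
    theorem then says that if P has a zero in the open polydisc, it has one with
    |z2| = |z3|.  For fixed z1 the polynomial is a - b z - c w + d z w; given a
    zero (z0,w0) with |w0| <= |z0|, the function |z|^2 |c - d z|^2 - |a - b z|^2
    is nonpositive at 0 and nonnegative at z0, hence vanishes at some z on the
    segment [0,z0]; there a - b z = eta z (c - d z) for some unimodular eta,
    i.e. (z, eta z) is a zero. *)

Lemma det_mx33 (K : comNzRingType) (A : 'M[K]_3) :
  \det A = A 0 0 * (A 1 1 * A 2 2 - A 1 2 * A 2 1)
         - A 0 1 * (A 1 0 * A 2 2 - A 1 2 * A 2 0)
         + A 0 2 * (A 1 0 * A 2 1 - A 1 1 * A 2 0).
Proof.
rewrite (expand_det_row _ 0) !big_ord_recl big_ord0 /cofactor.
rewrite !(expand_det_row _ 0) !big_ord_recl !big_ord0 /cofactor !det_mx11 !mxE.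
have e1 : lift 0 0 = 1 :> 'I_3 by apply/val_inj.
have e2 : lift 0 1 = 2 :> 'I_3 by apply/val_inj.
have e3 : lift 1 0 = 0 :> 'I_3 by apply/val_inj.
have e4 : lift 1 1 = 2 :> 'I_3 by apply/val_inj.
have e5 : lift 2 0 = 0 :> 'I_3 by apply/val_inj.
have e6 : lift 2 1 = 1 :> 'I_3 by apply/val_inj.
have e7 : lift 0 0 = 1 :> 'I_2 by apply/val_inj.
have e8 : lift 1 0 = 0 :> 'I_2 by apply/val_inj.
rewrite ?(e1, e7, e8, e2, e3, e4, e5, e6) /=; ring.
Qed.

(** * Zeros with coordinates of equal modulus *)

Lemma exists_equimodular_zero_le (R : realType) (a b c d z w : R[i]) :
  `|w| <= `|z| -> a - b * z - c * w + d * z * w = 0 ->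
  exists u eta : R[i], [/\ `|u| <= `|z|, `|eta| = 1 &
    a - b * u - c * (eta * u) + d * u * (eta * u) = 0].
Proof.
move=> wz zw0.
(* The squared modulus of [u - t v], written as a real polynomial in the real variable [t] so that
   the intermediate value theorem applies to it. *)
pose sq (u v : R[i]) : {poly R} :=
  ((complex.Re u)%:P - complex.Re v *: 'X) ^+ 2
  + ((complex.Im u)%:P - complex.Im v *: 'X) ^+ 2.
have sqE u v t : (sq u v).[t]%:C = `|u - t%:C * v| ^+ 2.
  rewrite -add_Re2_Im2 /sq !hornerE; congr (_%:C).
  by case: u v => [u1 u2] [v1 v2]; simpc => /=; ring.
pose r := complex.Re `|z|.
have rE : r%:C = `|z| by rewrite RRe_real ?normr_real.
pose p := (r ^+ 2) *: ('X^2 * sq c (d * z)) - sq a (b * z).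
have pE t : p.[t]%:C =
    (`|t%:C * z| * `|c - t%:C * (d * z)|) ^+ 2 - `|a - t%:C * (b * z)| ^+ 2.
  rewrite /p hornerE hornerZ hornerN hornerM hornerXn.
  rewrite rmorphB rmorphM rmorphXn rmorphM rmorphXn /= !sqE rE.
  have tR : t%:C \is Num.real by apply/complex_realP; exists t.
  rewrite normrM !exprMn (real_normK tR).
  by ring.
have [|t /andP[t0 t1] /rootP pt0] := @poly_ivt _ p 0 1 ler01.
  rewrite -!lecR !pE /= !mul0r normr0 mul0r expr0n sub0r oppr_le0 exprn_ge0 //=.
  rewrite !mul1r subr_ge0 ler_sqr ?nnegrE ?mulr_ge0 //.
  have -> : a - b * z = w * (c - d * z).
    by apply/eqP; rewrite -subr_eq0 -zw0; apply/eqP; ring.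
  by rewrite normrM ler_wpM2r.
have := pE t; rewrite pt0 => /esym/eqP.
rewrite subr_eq0 eqrXn2 ?mulr_ge0 // -normrM => /eqP nE.
set u := t%:C * z; exists u.
have uz : `|u| <= `|z|.
  by rewrite normrM ler_piMl // ger0_norm ?lecR.
have eqn : `|a - b * u| = `|u * (c - d * u)|.
  have -> : a - b * u = a - t%:C * (b * z) by rewrite /u; ring.
  by rewrite -nE /u; congr `|_|; ring.
(* If this vanishes, so does [a - b * u], and every [eta] works; otherwise [eta] is the quotient of
   two numbers of equal modulus. *)
have [f0|f0] := eqVneq (u * (c - d * u)) 0.
  exists 1; split; rewrite ?normr1 // mul1r.
  have /eqP : `|a - b * u| = 0 by rewrite eqn f0 normr0.
  by rewrite normr_eq0 => /eqP aE; rewrite -[RHS](subr0 0) -{1}aE -f0; ring.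
exists ((a - b * u) / (u * (c - d * u))); split=> //.
  by rewrite normf_div eqn divff ?normr_eq0.
set e := _ / _; have /eqP eE : e * (u * (c - d * u)) == a - b * u.
  by rewrite divfK.
by rewrite -[RHS](subrr (a - b * u)) -{3}eE; ring.
Qed.

Lemma exists_equimodular_zero (R : realType) (a b c d z w : R[i]) :
  `|z| < 1 -> `|w| < 1 -> a - b * z - c * w + d * z * w = 0 ->
  exists u eta : R[i], [/\ `|u| < 1, `|eta| = 1 &
    a - b * u - c * (eta * u) + d * u * (eta * u) = 0].
Proof.
move=> z1 w1 zw0.
have /orP[wz|zw] := real_leVge (normr_real w) (normr_real z).
  have [u [e [uz e1 ue0]]] := exists_equimodular_zero_le wz zw0.
  by exists u, e; split=> //; apply: le_lt_trans z1.
have wz0 : a - c * w - b * z + d * w * z = 0 by rewrite -zw0; ring.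
have [u [e [uw e1 ue0]]] := exists_equimodular_zero_le zw wz0.
have e0 : e != 0 by rewrite -normr_eq0 e1 oner_eq0.
(* With the coordinates exchanged, the zero found is [(z, w) = (e * u, u)], whose ratio [w / z] is
   [e^-1]. *)
exists (e * u), e^-1; split; first by rewrite normrM e1 mul1r (le_lt_trans uw).
  by rewrite normfV e1 invr1.
by rewrite mulKf // -ue0; ring.
Qed.

(** * Diagonal matrices: operator norm and the condition [mu E A <= 1] *)

Lemma normc_Re (R : realType) (z : R[i]) : (complex.Re `|z|)%:C = `|z|.
Proof. by rewrite RRe_real ?normr_real. Qed.

Lemma Re_normc_ge0 (R : realType) (z : R[i]) : 0 <= complex.Re `|z|.
Proof. by rewrite -lecR normc_Re normr_ge0. Qed.

Lemma l2norm_diag_le (R : realType) n (d : 'rV[R[i]]_n) (m : R) v :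
  0 <= m -> (forall j, `|d 0 j| <= m%:C) ->
  l2norm (diag_mx d *m v) <= m * l2norm v.
Proof.
move=> m0 dm; rewrite /l2norm -[X in X * _]ger0_norm //.
rewrite -sqrtr_sqr -sqrtrM ?sqr_ge0 //.
apply: ler_wsqrtr; rewrite mulr_sumr; apply: ler_sum => i _.
rewrite -exprMn ler_sqr ?nnegrE ?mulr_ge0 ?Re_normc_ge0 //.
by rewrite mul_diag_mx mxE -lecR rmorphM /= !normc_Re normrM ler_wpM2r.
Qed.

Lemma opnorm_diag_le (R : realType) n (d : 'rV[R[i]]_n) (m : R) :
  0 <= m -> (forall j, `|d 0 j| <= m%:C) -> opnorm (diag_mx d) <= m.
Proof.
move=> m0 dm; apply: ge_sup => [|_ [v /= v1 <-]].
  exists (l2norm (diag_mx d *m 0)), 0 => //=.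
  rewrite /l2norm big1 ?sqrtr0 // => i _.
  by rewrite mxE normr0 expr0n.
by rewrite (le_trans (l2norm_diag_le v m0 dm)) // ler_piMr.
Qed.

Lemma le_opnorm_diag (R : realType) n (d : 'rV[R[i]]_n) k :
  complex.Re `|d 0 k| <= opnorm (diag_mx d).
Proof.
have l2k (a : R[i]) : l2norm (a *: delta_mx k 0 : 'cV_n) = complex.Re `|a|.
  rewrite /l2norm (bigD1 k) // big1 => [|i /andP[_ /negPf ik]].
    by rewrite !mxE !eqxx mulr1 [X in Num.sqrt X]addr0 sqrtr_sqr
      ger0_norm ?Re_normc_ge0.
  by rewrite !mxE ik mulr0 normr0 expr0n.
(* A crude bound, used only to show that the set under the supremum is bounded above. *)
pose m := \sum_j complex.Re `|d 0 j|.
have m0 : 0 <= m by apply: sumr_ge0 => j _; exact: Re_normc_ge0.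
have dm j : `|d 0 j| <= m%:C.
  rewrite -normc_Re lecR /m (bigD1 j) //= lerDl.
  by apply: sumr_ge0 => i _; exact: Re_normc_ge0.
apply: ub_le_sup.
  exists m => _ [v /= v1 <-].
  by rewrite (le_trans (l2norm_diag_le v m0 dm)) // ler_piMr.
exists (delta_mx k 0); first by rewrite /= -[delta_mx k 0]scale1r l2k normr1.
rewrite -l2k; congr l2norm; apply/matrixP => i j.
by rewrite mul_diag_mx !mxE; case: eqVneq => [->|] //=; rewrite !mulr0.
Qed.

(** Take [v] nonzero with [v = v A D] and compare moduli at its largest entry [k]:
    [|v_k| <= m |v_k| |d_k|]. Using [1 + m] covers [A = 0]. This makes the infimum in [mu] positive,
    so that its inverse is genuine. *)
Lemma singular_diag_bound (R : realType) n (A : 'M[R[i]]_n) :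
  exists2 delta : R, 0 < delta & forall d : 'rV_n,
    \det (1%:M - A *m diag_mx d) = 0 ->
    exists k, delta <= complex.Re `|d 0 k|.
Proof.
pose m := \sum_i \sum_j `|A i j|.
have m0 : 0 <= m by apply: sumr_ge0 => i _; apply: sumr_ge0.
have m1 : 0 < 1 + m by rewrite ltr_wpDr.
have mE : (complex.Re (1 + m)^-1)%:C = (1 + m)^-1.
  by rewrite RRe_real // ger0_real // invr_ge0 ltW.
exists (complex.Re (1 + m)^-1) => [|d /eqP/det0P[v v0]].
  by rewrite -ltcR mE invr_gt0.
rewrite mulmxBr mulmx1 => /eqP; rewrite subr_eq0 => /eqP vE.
have [i0 vi0] : exists i0, v 0 i0 != 0.
  apply/existsP; apply: contraNT v0; rewrite negb_exists => /forallP v0.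
  by apply/eqP/rowP => j; rewrite mxE; apply/eqP; move: (v0 j); rewrite negbK.
case: (@arg_maxP _ _ _ i0 predT (fun j => complex.Re `|v 0 j|)) => // k _ vmax.
exists k.
have vk j : `|v 0 j| <= `|v 0 k|.
  by rewrite -normc_Re -[leRHS]normc_Re lecR; exact: vmax.
have vk0 : 0 < `|v 0 k| by rewrite (lt_le_trans _ (vk i0)) // normr_gt0.
rewrite -lecR mE normc_Re -div1r ler_pdivrMr //.
rewrite -(ler_pM2r vk0) mul1r.
have {1}-> : v 0 k = (\sum_i v 0 i * A i k) * d 0 k.
  by rewrite {1}vE mulmxA mul_mx_diag !mxE.
rewrite normrM mulrC -mulrA ler_wpM2l // (le_trans (ler_norm_sum _ _ _)) //.
rewrite mulrDl mul1r ler_wpDl ?normr_ge0 // /m mulr_suml; apply: ler_sum => i _.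
rewrite normrM mulrC ler_pM //.
by rewrite (bigD1 k) //= lerDl sumr_ge0.
Qed.

(** After inversion, the infimum of the norms of singularizers must be at least 1, and a diagonal
    matrix has norm less than 1 exactly when all its entries do. *)
Lemma mu_le1P (R : realType) n (E : set 'M[R[i]]_n) (A : 'M[R[i]]_n) :
  (forall X, E X -> exists d, X = diag_mx d) ->
  mu E A <= 1 <->
  forall d, E (diag_mx d) -> (forall j, `|d 0 j| < 1) ->
    \det (1%:M - A *m diag_mx d) != 0.
Proof.
move=> Ediag; have [delta delta0 deltaP] := singular_diag_bound A.
rewrite /mu; case: asboolP => [E0|/eqP/set0P[X0 X0s]].
  split=> // _ d Ed _; apply/eqP => dA.
  by have : singularizers E A (diag_mx d) by []; rewrite E0.
set S := [set opnorm X | X in _]%classic.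
have S0 : (S !=set0)%classic by exists (opnorm X0), X0.
have Slb : lbound S delta.
  move=> _ [X [EX XA] <-]; have [d Xd] := Ediag X EX.
  rewrite {}Xd in XA *; have [k dk] := deltaP d XA.
  exact: le_trans dk (le_opnorm_diag d k).
have infS0 : 0 < inf S by apply: lt_le_trans (lb_le_inf S0 Slb).
rewrite invf_le1 //; split=> [S1 d Ed d1|AP].
  apply/eqP => dA.
  pose m := \big[Num.max/0]_j complex.Re `|d 0 j|.
  have m1 : m < 1.
    by apply: bigmax_lt => // j _; rewrite -ltcR normc_Re.
  have m0 : 0 <= m by rewrite /m; apply: bigmax_ge_id.
  have : opnorm (diag_mx d) <= m.
    by apply: opnorm_diag_le => // j; rewrite -normc_Re lecR; apply: le_bigmax.
  apply/negP; rewrite -ltNge (lt_le_trans m1) // (le_trans S1) //.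
  by apply: ge_inf; [exists delta | exists (diag_mx d)].
apply: lb_le_inf => // _ [X [EX XA] <-]; have [d Xd] := Ediag X EX.
rewrite {}Xd in EX XA *; rewrite leNgt; apply/negP => d1.
move: (AP d EX); rewrite XA eqxx => /(_ _)/negP; apply => // j.
by rewrite -normc_Re -[1]/(1%:C) ltcR (le_lt_trans (le_opnorm_diag d j)).
Qed.

(** * Matrices with prescribed invariants *)

(** The minors fix the diagonal and the products [al], [be], [ga] of opposite entries; the
    determinant then fixes the sum [s] of the two cyclic products. Their product is [al * be * ga],
    so they are the roots of a quadratic with discriminant [r ^+ 2]. *)
Lemma pi_111_surj (R : realType) (x1 x2 x3 x4 x5 x6 x7 : R[i]) :
  exists A, pi_111 A = [tuple x1; x2; x3; x4; x5; x6; x7].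
Proof.
pose al := x1 * x2 - x3; pose be := x1 * x4 - x5; pose ga := x2 * x4 - x6.
pose s := x7 - x1 * x2 * x4 + x1 * ga + x2 * be + x4 * al.
pose r := sqrtC (s ^+ 2 - 4 * (al * be * ga)).
have rE : r ^+ 2 = s ^+ 2 - 4 * (al * be * ga) by rewrite sqrtCK.
pose mx33 a12 a13 a21 a23 a31 a32 : 'M[R[i]]_3 :=
  \matrix_(i < 3, j < 3) (nth [::] [:: [:: x1; a12; a13]; [:: a21; x2; a23];
                                       [:: a31; a32; x4]] i)`_j.
have mx33P a12 a13 a21 a23 a31 a32 :
    a12 * a21 = al -> a13 * a31 = be -> a23 * a32 = ga ->
    a12 * a23 * a31 + a13 * a32 * a21 = s ->
    pi_111 (mx33 a12 a13 a21 a23 a31 a32) = [tuple x1; x2; x3; x4; x5; x6; x7].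
  move=> alE beE gaE sE; apply/val_inj; rewrite /= det_mx33 !mxE /=.
  rewrite alE beE gaE; congr [:: _; _; _; _; _; _; _];
    [by rewrite /al; ring | by rewrite /be; ring | by rewrite /ga; ring |].
  transitivity (x1 * x2 * x4 - x1 * ga - x2 * be - x4 * al + s).
    by rewrite -sE -alE -beE -gaE; ring.
  by rewrite /s; ring.
(* p = a12 a23 a31 and q = a13 a32 a21 are the two cyclic products. *)
have [p [q [pq spq]]] : exists p q, p * q = al * be * ga /\ p + q = s.
  exists ((s + r) / 2), ((s - r) / 2); split; last by field.
  transitivity ((s ^+ 2 - r ^+ 2) / 4); first by field.
  by rewrite rE; field.
wlog p0 : p q pq spq / p != 0 \/ p = 0 /\ q = 0.
  move=> H; have [p0|p0] := eqVneq p 0; last by apply: (H p q) => //; left.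
  have [q0|q0] := eqVneq q 0; first by apply: (H p q) => //; right.
  by apply: (H q p); [rewrite mulrC | rewrite addrC | left].
case: p0 => [p0|[p0 q0]].
  exists (mx33 1 (be / p) al 1 p ga); apply: mx33P; rewrite ?mul1r ?divfK //.
  by rewrite -spq; congr (_ + _); apply: (mulfI p0); rewrite pq; field.
have s0 : 0 = s by rewrite -spq p0 q0 addr0.
(* One of [al], [be], [ga] is 0; setting both entries of that pair to 0 kills both cyclic
   products. *)
have /eqP := pq; rewrite p0 mul0r eq_sym !mulf_eq0 -orbA => /or3P[] /eqP z0.
- by exists (mx33 0 1 0 1 be ga); apply: mx33P;
    rewrite ?mul1r ?mul0r ?mulr0 ?addr0.
- by exists (mx33 1 0 al 1 0 ga); apply: mx33P;
    rewrite ?mul1r ?mul0r ?mulr0 ?addr0.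
by exists (mx33 1 1 al 0 be 0); apply: mx33P;
    rewrite ?mul1r ?mul0r ?mulr0 ?addr0.
Qed.

(** * Membership as nonvanishing on a polydisc *)

Lemma det_pi_111 (R : realType) (A : 'M[R[i]]_3) x1 x2 x3 x4 x5 x6 x7 z1 z2 z3 :
  pi_111 A = [tuple x1; x2; x3; x4; x5; x6; x7] ->
  \det (1%:M - A *m diag_mx (\row_(j < 3) [:: z1; z2; z3]`_j)) =
  1 - x1 * z1 - x2 * z2 + x3 * z1 * z2 - x4 * z3 + x5 * z1 * z3
  + x6 * z2 * z3 - x7 * z1 * z2 * z3.
Proof.
move=> /(congr1 val) /= [<- <- <- <- <- <- <-].
by rewrite !det_mx33 mul_mx_diag !mxE /=; ring.
Qed.

Lemma Gamma_3_3_111P (R : realType) (x1 x2 x3 x4 x5 x6 x7 : R[i]) :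
  Gamma_3_3_111 [tuple x1; x2; x3; x4; x5; x6; x7] <->
  forall z1 z2 z3, `|z1| < 1 -> `|z2| < 1 -> `|z3| < 1 ->
    1 - x1 * z1 - x2 * z2 + x3 * z1 * z2 - x4 * z3 + x5 * z1 * z3
    + x6 * z2 * z3 - x7 * z1 * z2 * z3 != 0.
Proof.
have Ediag X : @E_3_3_111 R X -> exists d, X = diag_mx d.
  by move=> [z1 [z2 [z3 ->]]]; eexists.
split=> [[A /= /(mu_le1P _ Ediag) muA piA] z1 z2 z3 z11 z21 z31|H].
  rewrite -(det_pi_111 _ _ _ piA); apply: muA; first by exists z1, z2, z3.
  by move=> [[|[|[|]]] // ?]; rewrite mxE.
have [A piA] := pi_111_surj x1 x2 x3 x4 x5 x6 x7.
exists A => //=; apply/(mu_le1P _ Ediag) => d [z1 [z2 [z3 dE]]] d1.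
have diagE j : d 0 j = diag_mx d j j by rewrite mxE eqxx.
rewrite dE (det_pi_111 _ _ _ piA); apply: H.
- by have := d1 0; rewrite diagE dE !mxE.
- by have := d1 1; rewrite diagE dE !mxE.
- by have := d1 2; rewrite diagE dE !mxE.
Qed.

Lemma det_pi_12 (R : realType) (A : 'M[R[i]]_3) y1 y2 y3 y4 y5 z1 z2 :
  pi_12 A = [tuple y1; y2; y3; y4; y5] ->
  \det (1%:M - A *m diag_mx (\row_(j < 3) [:: z1; z2; z2]`_j)) =
  1 - y1 * z1 - y4 * z2 + y2 * z1 * z2 + y5 * z2 ^+ 2 - y3 * z1 * z2 ^+ 2.
Proof.
move=> /(congr1 val) /= [<- <- <- <- <-].
by rewrite !det_mx33 mul_mx_diag !mxE /=; ring.
Qed.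

Lemma Gamma_3_2_12P (R : realType) (y1 y2 y3 y4 y5 : R[i]) :
  Gamma_3_2_12 [tuple y1; y2; y3; y4; y5] <->
  forall z1 z2, `|z1| < 1 -> `|z2| < 1 ->
    1 - y1 * z1 - y4 * z2 + y2 * z1 * z2 + y5 * z2 ^+ 2 - y3 * z1 * z2 ^+ 2 != 0.
Proof.
have Ediag X : @E_3_2_12 R X -> exists d, X = diag_mx d.
  by move=> [z1 [z2 ->]]; eexists.
split=> [[A /= /(mu_le1P _ Ediag) muA piA] z1 z2 z11 z21|H].
  rewrite -(det_pi_12 _ _ piA); apply: muA; first by exists z1, z2.
  by move=> [[|[|[|]]] // ?]; rewrite mxE.
(* [pi_12] is the image of [pi_111] under [(x1, x3 + x5, x7, x2 + x4, x6)], so [x4 = x5 = 0] gives a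
   preimage. *)
have [A /(congr1 val) /= []] := pi_111_surj y1 y4 y2 0 0 y5 y3.
move=> a1 a2 a3 a4 a5 a6 a7.
have piA : pi_12 A = [tuple y1; y2; y3; y4; y5].
  by apply/val_inj; rewrite /= a3 a5 a6 a7 a1 a2 a4 !addr0.
exists A => //=; apply/(mu_le1P _ Ediag) => d [z1 [z2 dE]] d1.
have diagE j : d 0 j = diag_mx d j j by rewrite mxE eqxx.
rewrite dE (det_pi_12 _ _ piA); apply: H.
- by have := d1 0; rewrite diagE dE !mxE.
- by have := d1 1; rewrite diagE dE !mxE.
Qed.

Theorem theorem2p48 (R : realType) (x1 x2 x3 x4 x5 x6 x7 : R[i]) :
  Gamma_3_3_111 [tuple x1; x2; x3; x4; x5; x6; x7] <->
  (forall eta : R[i], `|eta| = 1 ->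
     Gamma_3_2_12
       [tuple x1; x3 + eta * x5; eta * x7; x2 + eta * x4; eta * x6]).
Proof.
split=> [/Gamma_3_3_111P H eta eta1|H].
  apply/Gamma_3_2_12P => z1 z2 z11 z21.
  (* The two-variable polynomial at [(z1, z2)] is the three-variable one at [(z1, z2, eta * z2)]. *)
  have ez : `|eta * z2| < 1 by rewrite normrM eta1 mul1r.
  by apply: contra (H z1 z2 (eta * z2) z11 z21 ez) => /eqP <-; apply/eqP; ring.
apply/Gamma_3_3_111P => z1 z2 z3 z11 z21 z31; apply/eqP => P0.
(* For fixed [z1] the polynomial is affine in each of [z2] and [z3], with these coefficients. *)
have [|u [eta [u1 eta1 Q0]]] := @exists_equimodular_zero R (1 - x1 * z1)
    (x2 - x3 * z1) (x4 - x5 * z1) (x6 - x7 * z1) z2 z3 z21 z31.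
  by rewrite -P0; ring.
have /Gamma_3_2_12P/(_ z1 u z11 u1)/eqP := H eta eta1; apply.
by rewrite -Q0; ring.
Qed.
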